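(* Let $0<\delta\le 1$ and let $A=(a_{ij})$ be an $n\times n$ real matrix with $\delta\le a_{ij}\le 1$ for all $i,j$. For a permutation $\sigma\in S_n$ let $c(\sigma)$ denote the number of cycles of $\sigma$. Then $$\sum_{\substack{\sigma\in S_n:\\ c(\sigma)\le 4+4\delta^{-2}\ln n}}\ \prod_{i=1}^n a_{i\sigma(i)}\ \ge\ \frac12\operatorname{per}A .$$
   Context: $S_n$ is the symmetric group of permutations of $\{1,\dots,n\}$, and the permanent is $\operatorname{per}A=\sum_{\sigma\in S_n}\prod_{i=1}^n a_{i\sigma(i)}$. The cycles of $\sigma$ include fixed points (cycles of length 1). *)

(* Defs.v *)
From HB Require Import structures.
From mathcomp Require Import all_boot all_order all_algebra all_fingroup.
From mathcomp Require Import all_classical all_reals all_analysis.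

Set Implicit Arguments.
Unset Strict Implicit.
Unset Printing Implicit Defensive.

Import Order.TTheory GRing.Theory Num.Theory.
Local Open Scope ring_scope.

Definition permanent (R : comNzRingType) (n : nat) (A : 'M[R]_n) : R :=
  \sum_(s : 'S_n) \prod_(i < n) A i (s i).

(* [porbits s] is the set of all orbits of s, singletons included, so fixed
   points are counted as cycles of length 1. *)
Definition num_cycles (n : nat) (s : 'S_n) : nat := #|porbits s|.

(* Main.v *)
(** Weight a permutation by the product of its entries and normalise by [per A].
    The number of cycles is the number of [i] that are minimal in their own
    cycle.  If [i] is minimal in its cycle of [s] and [j < i], then
    [s * (i j)] merges the cycles of [i] and [j] and loses a factor at most
    [delta ^ 2] of the weight; [j] is recovered from it as the first element
    below [i] met on the orbit of [i].  Hence, numbering from [0], [i] is minimal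
    in its cycle with probability at most [1 / (1 + i delta ^ 2)], the expected
    number of cycles is at most [1 + delta ^ -2 ln n], and Markov's inequality
    concludes. *)

Require Import Defs.
From HB Require Import structures.
From mathcomp Require Import all_boot all_order all_algebra all_fingroup.
From mathcomp Require Import all_classical all_reals all_analysis.
From mathcomp Require Import ring lra.

Set Implicit Arguments.
Unset Strict Implicit.
Unset Printing Implicit Defensive.

Import Order.TTheory GRing.Theory Num.Theory.
Local Open Scope ring_scope.

Definition cycle_min (n : nat) (s : 'S_n) (i : 'I_n) : bool :=
  [forall j in porbit s i, (i <= j)%N].

(** Every orbit is the orbit of its least element. *)
Lemma num_cycles_le_cycle_min n (s : 'S_n) :
  (num_cycles s <= \sum_(i < n) cycle_min s i)%N.
Proof.
rewrite /num_cycles -big_mkcond /= sum1_card.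
have sub : porbits s \subset porbit s @: [set i | cycle_min s i].
  apply/fintype.subsetP => _ /imsetP[x _ ->].
  case: (arg_minnP (fun j : 'I_n => j : nat) (porbit_id s x)) => i xi imin.
  have eqp : porbit s i = porbit s x by apply/eqP; rewrite eq_porbit_mem.
  apply/imsetP; exists i; rewrite ?eqp // inE.
  by apply/forall_inP => j; rewrite eqp => /imin.
rewrite (leq_trans (subset_leq_card sub)) // (leq_trans (leq_imset_card _ _)) //.
by apply/subset_leq_card/fintype.subsetP => i; rewrite inE.
Qed.

Lemma cycle_min_iter n (s : 'S_n) i k : cycle_min s i -> (i <= iter k s i)%N.
Proof. by move/forall_inP; apply; rewrite -permX mem_porbit. Qed.

(** The product applies [s] first, so the walk from [i] follows its [s]-cycle, all of it at least
    [i], until the step that would return to [i] is diverted to [j]. *)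
Lemma merge_first_below n (s : 'S_n) (i j : 'I_n) :
  cycle_min s i -> (j < i)%N ->
  exists2 m, iter m (s * tperm i j)%g i = j &
    forall l, (l < m)%N -> (i <= iter l (s * tperm i j)%g i)%N.
Proof.
move=> imin ji.
have exm : exists m, (0 < m)%N && (iter m s i == i).
  by exists #[s]%g; rewrite order_gt0 -permX expg_order perm1 eqxx.
case: (ex_minnP exm) => m /andP[m0 /eqP im] mmin.
(* Before the first return time [m], the [s]-walk from [i] avoids [i] by the choice of [m] and [j]
   because [j < i], so the transposition does not act. *)
have eqs l : (l < m)%N -> iter l (s * tperm i j)%g i = iter l s i.
  elim: l => // l IH lm; rewrite iterS IH ?(ltnW lm) // permM -iterS tpermD //.
    apply/eqP => e; have := mmin l.+1; rewrite -e eqxx => /(_ isT).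
    by rewrite leqNgt lm.
  by apply/eqP => e; have := cycle_min_iter l.+1 imin; rewrite -e leqNgt ji.
exists m; last by move=> l lm; rewrite eqs // cycle_min_iter.
case: m m0 im {mmin} eqs => // m _ im eqs.
by rewrite iterS eqs // permM -iterS im tpermL.
Qed.

Lemma merge_not_cycle_min n (s : 'S_n) (i j : 'I_n) :
  cycle_min s i -> (j < i)%N -> ~~ cycle_min (s * tperm i j)%g i.
Proof.
move=> imin ji; have [m em _] := merge_first_below imin ji.
by apply/negP => /cycle_min_iter - /(_ m); rewrite em leqNgt ji.
Qed.

(** Both [j] and [j'] are the first element below [i] on the same walk, so they agree; then cancel
    the transposition. *)
Lemma merge_inj n (i : 'I_n) (s s' : 'S_n) (j j' : 'I_n) :
  cycle_min s i -> cycle_min s' i -> (j < i)%N -> (j' < i)%N ->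
  (s * tperm i j = s' * tperm i j')%g -> s = s' /\ j = j'.
Proof.
move=> imin imin' ji ji' e.
have [m em lm] := merge_first_below imin ji.
have [m' em' lm'] := merge_first_below imin' ji'.
have ejj : j = j'.
  case: (ltngtP m m') => [h|h|h]; last by rewrite -em -em' h e.
    by have := lm' _ h; rewrite -e em leqNgt ji.
  by have := lm _ h; rewrite e em' leqNgt ji'.
by split=> //; move: e; rewrite ejj => /mulIg.
Qed.

(** Induction on [m]: with [y = x + d], the bound [ln (x / y) <= x / y - 1 = - d / y] shows that
    each new term is at most the increment of the right side. *)
Lemma sum_inv_ln (R : realType) (d : R) m : 0 < d <= 1 ->
  \sum_(i < m.+1) (1 + d * i%:R)^-1 <= 1 + d^-1 * ln (1 + d * m%:R).
Proof.
move=> /andP[d0 d1]; elim: m => [|m IH].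
  by rewrite big_ord1 !mulr0 addr0 ln1 mulr0 addr0 invr1.
rewrite big_ord_recr /=; apply: (le_trans (lerD IH (lexx _))).
rewrite -addrA lerD2l -lerBrDl -mulrBr ler_pdivlMl //.
set x := 1 + d * m%:R; set y := 1 + d * _.
have m0 : 0 <= d * m%:R by rewrite mulr_ge0 // ltW.
have x0 : 0 < x by rewrite /x; lra.
have yx : y = x + d by rewrite /x /y -natr1; ring.
have y0 : 0 < y by lra.
have -> : d * y^-1 = 1 - x / y by rewrite yx; field; rewrite -yx lt0r_neq0.
have := @le_ln1Dx R (x / y - 1).
rewrite addrCA subrr addr0 ln_div ?posrE //.
have xy0 : 0 < x / y by rewrite divr_gt0.
by move=> h; have := h ltac:(lra); lra.
Qed.

Section WeightedPermutations.
Variables (R : realType) (n : nat) (delta : R) (A : 'M[R]_n).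
Hypothesis hdelta : 0 < delta <= 1.
Hypothesis hA : forall i j : 'I_n, delta <= A i j <= 1.

Let w (s : 'S_n) : R := \prod_(i < n) A i (s i).

Lemma entry_ge0 i j : 0 <= A i j.
Proof. by move: hdelta (hA i j) => /andP[d0 _] /andP[h _]; lra. Qed.

Lemma perm_weight_ge0 s : 0 <= w s.
Proof. by apply: prodr_ge0 => i _; apply: entry_ge0. Qed.

(** Only the rows [a] and [b] that [s] sends to [i] and [j] change: their old entries are at most 1,
    their new ones at least [delta]. *)
Lemma perm_weight_tperm s (i j : 'I_n) :
  i != j -> delta ^+ 2 * w s <= w (s * tperm i j)%g.
Proof.
move=> ij; rewrite /w; set a := (s^-1)%g i; set b := (s^-1)%g j.
have ab : b != a by rewrite (inj_eq perm_inj) eq_sym.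
rewrite (bigD1 a) //= (bigD1 b) //= [leRHS](bigD1 a) //=.
rewrite [X in _ <= _ * X](bigD1 b) //=.
have -> : \prod_(k < n | (k != a) && (k != b)) A k ((s * tperm i j)%g k) =
          \prod_(k < n | (k != a) && (k != b)) A k (s k).
  apply: eq_bigr => k /andP[ka kb]; rewrite permM tpermD //.
    by apply: contra ka => /eqP e; rewrite /a e permK.
  by apply: contra kb => /eqP e; rewrite /b e permK.
rewrite !mulrA ler_wpM2r //.
  by apply: prodr_ge0 => k _; apply: entry_ge0.
rewrite !permM !permKV tpermL tpermR.
move: hdelta (hA a i) (hA b j) (hA a j) (hA b i).
move=> /andP[d0 _] /andP[h1 h2] /andP[h3 h4] /andP[h5 h6] /andP[h7 h8].
apply: (@le_trans _ _ (delta ^+ 2)).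
  rewrite -mulrA ler_piMr ?sqr_ge0 // mulr_ile1 //; lra.
by rewrite expr2 ler_pM //; lra.
Qed.

Lemma cycle_min_weight (i : 'I_n) :
  (1 + delta ^+ 2 * i%:R) * (\sum_(s | cycle_min s i) w s) <= permanent A.
Proof.
rewrite /permanent [leRHS](bigID (fun s => cycle_min s i)) /=.
rewrite mulrDl mul1r lerD2l.
(* What remains is to inject the pairs [(s, j)], with [i] choices of [j] for each [s], into the
   permutations where [i] is not minimal. *)
pose P := [set p : 'S_n * 'I_n | cycle_min p.1 i && (p.2 < i)%N].
pose f (p : 'S_n * 'I_n) := (p.1 * tperm i p.2)%g.
have -> : delta ^+ 2 * i%:R * (\sum_(s | cycle_min s i) w s) =
          \sum_(p in P) delta ^+ 2 * w p.1.
  under [RHS]eq_bigl do rewrite inE.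
  rewrite -(pair_big (fun s => cycle_min s i) (fun j : 'I_n => (j < i)%N)
    (fun s _ => delta ^+ 2 * w s)) /=.
  rewrite mulr_sumr; apply: eq_bigr => s _.
  rewrite (big_ord_narrow (ltnW (ltn_ord i))) /= sumr_const card_ord.
  by rewrite mulrAC mulr_natr.
apply: (@le_trans _ _ (\sum_(p in P) w (f p))).
  apply: ler_sum => -[s j]; rewrite inE /= => /andP[_ ji].
  by apply: perm_weight_tperm; rewrite -val_eqE /= gtn_eqF.
rewrite -(big_imset w) /=; last first.
  move=> [s j] [s' j']; rewrite !inE /= => /andP[h1 h2] /andP[h3 h4] e.
  by have [-> ->] := merge_inj h1 h3 h2 h4 e.
rewrite [leRHS](bigID (mem (f @: P))) /=.
rewrite (eq_bigl (fun s => ~~ cycle_min s i && (s \in f @: P))).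
  by rewrite lerDl sumr_ge0 // => s _; apply: perm_weight_ge0.
move=> s; rewrite andbC; case: imsetP => //= -[[t j]].
rewrite inE /= => /andP[h1 h2] ->.
by rewrite merge_not_cycle_min.
Qed.

Lemma sum_num_cycles_weight : (0 < n)%N ->
  \sum_s (num_cycles s)%:R * w s <= (1 + delta ^- 2 * ln n%:R) * permanent A.
Proof.
move=> n0.
have /andP[d0 d1] := hdelta.
have D0 : 0 < delta ^+ 2 by rewrite exprn_gt0.
have D1 : delta ^+ 2 <= 1 by rewrite exprn_ile1 // ltW.
have per0 : 0 <= permanent A by apply: sumr_ge0 => s _; apply: perm_weight_ge0.
apply: (@le_trans _ _ (\sum_s \sum_(i < n | cycle_min s i) w s)).
  apply: ler_sum => s _.
  rewrite sumr_const -[leRHS]mulr_natl ler_wpM2r ?perm_weight_ge0 // ler_nat.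
  by rewrite (leq_trans (num_cycles_le_cycle_min s)) // -big_mkcond sum1_card.
rewrite (exchange_big_dep xpredT) //=.
apply: (@le_trans _ _ (\sum_(i < n) (1 + delta ^+ 2 * i%:R)^-1 * permanent A)).
  apply: ler_sum => i _; rewrite ler_pdivlMl ?cycle_min_weight //.
  by rewrite ltr_pwDl // mulr_ge0 // ltW.
rewrite -mulr_suml ler_wpM2r //.
(* The last index is [n.-1]; as [delta ^+ 2 <= 1], the argument of the logarithm is at most [n]. *)
have := @sum_inv_ln R (delta ^+ 2) n.-1; rewrite D0 D1 prednK // => /(_ isT).
move/le_trans; apply.
rewrite lerD2l ler_wpM2l ?invr_ge0 ?(ltW D0) // ler_ln ?posrE ?ltr0n //.
  by rewrite -[in leRHS](prednK n0) -natr1 addrC lerD2r ler_piMl.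
by rewrite ltr_pwDl // mulr_ge0 // ltW.
Qed.

End WeightedPermutations.

Theorem theorem1p3 (R : realType) (n : nat) (delta : R) (A : 'M[R]_n)
    (hn : (0 < n)%N) (hdelta : 0 < delta <= 1)
    (hA : forall i j : 'I_n, delta <= A i j <= 1) :
  2^-1 * permanent A <=
    \sum_(s : 'S_n | (num_cycles s)%:R <= 4 + 4 * delta ^- 2 * ln (n%:R : R))
       \prod_(i < n) A i (s i).
Proof.
have w0 := perm_weight_ge0 hdelta hA.
have := sum_num_cycles_weight hdelta hA hn.
set E := 1 + _ * _; set S := 4 + _ => hE.
have -> : S = 4 * E by rewrite /S /E; ring.
have E1 : 1 <= E.
  rewrite lerDl mulr_ge0 ?ln_ge0 ?ler1n // invr_ge0 exprn_ge0 //.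
  by case/andP: hdelta => /ltW.
pose good (s : 'S_n) := (num_cycles s)%:R <= 4 * E.
(* Markov: each bad permutation has more than [4 * E] cycles. Cancelling [E > 0] then leaves the bad
   ones at most a quarter of the permanent. *)
have bad : 4 * E * (\sum_(s | ~~ good s) \prod_(i < n) A i (s i))
    <= E * permanent A.
  apply: le_trans hE; rewrite mulr_sumr [leRHS](bigID good) /=.
  apply: ler_wpDl; first by apply: sumr_ge0 => s _; rewrite mulr_ge0.
  apply: ler_sum => s; rewrite /good -ltNge => /ltW h.
  by rewrite ler_wpM2r.
pose good_weight := \sum_(s | good s) \prod_(i < n) A i (s i).
pose bad_weight := \sum_(s | ~~ good s) \prod_(i < n) A i (s i).
have per : permanent A = good_weight + bad_weight.
  by rewrite /permanent (bigID good).
have good0 : 0 <= good_weight by apply: sumr_ge0.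
rewrite -/bad_weight in bad; rewrite -/good_weight.
move: bad; rewrite (mulrC 4) -mulrA ler_pM2l; last by lra.
by lra.
Qed.
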